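(* Let $\mathcal{P}_v$ be the set of vectors ($\Re$-equivalence classes of arrows) of an arrow space $\mathcal{P}_A$ satisfying Axioms 1, 2, 4, 5 stated in the context. For any $[\overrightarrow{AB}],[\overrightarrow{CD}],[\overrightarrow{EF}]\in\mathcal{P}_v$: (1) $([\overrightarrow{AB}]+_V[\overrightarrow{CD}])+_V[\overrightarrow{EF}]=[\overrightarrow{AB}]+_V([\overrightarrow{CD}]+_V[\overrightarrow{EF}])$; (2) for any point $P\in\mathcal{P}$, $[\overrightarrow{AB}]+_V[\overrightarrow{PP}]=[\overrightarrow{AB}]$.
   Context: Let $\mathcal{P}$ be an infinite set whose elements are called points. An arrow is an ordered pair of points $\overrightarrow{AB}=(A,B)$ (tail $A$, head $B$; $A=B$ is allowed). The arrow space $\mathcal{P}_A$ is the set of all arrows; two arrows are equal iff they have the same tail and the same head. Negation: $-\overrightarrow{AB}=\overrightarrow{BA}$. Arrow addition is the partial operation $\overrightarrow{AB}+_A\overrightarrow{BC}=\overrightarrow{AC}$, defined exactly when the head of the first arrow equals the tail of the second. Axiom 1: there is a given map (arrow pre-inner product) $\langle -,-\rangle_A:\mathcal{P}_A\times\mathcal{P}_A\to\mathbb{R}$ such that for all points: $\langle\overrightarrow{AB},\overrightarrow{AB}\rangle_A\ge 0$, with equality iff $A=B$; $\langle\overrightarrow{AB},\overrightarrow{CD}\rangle_A=\langle\overrightarrow{CD},\overrightarrow{AB}\rangle_A$; $\langle\overrightarrow{AB}+_A\overrightarrow{BC},\overrightarrow{LM}\rangle_A=\langle\overrightarrow{AB},\overrightarrow{LM}\rangle_A+\langle\overrightarrow{BC},\overrightarrow{LM}\rangle_A$;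 $\langle-\overrightarrow{AB},\overrightarrow{CD}\rangle_A=-\langle\overrightarrow{AB},\overrightarrow{CD}\rangle_A$. Measure: $\|\overrightarrow{AB}\|_A=\sqrt{\langle\overrightarrow{AB},\overrightarrow{AB}\rangle_A}$. Scalar multiplication: for $t\in\mathbb{R}$, if $A=B$ or $t=0$ then $(t)\overrightarrow{AB}=\overrightarrow{AA}$. If $A\ne B$ and $t\neq0$ then $(t)\overrightarrow{AB}=\overrightarrow{AD}$, where $D\in\mathcal{P}$ is a point (assumed to exist) with $\|\overrightarrow{AD}\|_A=|t|\,\|\overrightarrow{AB}\|_A$ and $\langle\overrightarrow{AB},\overrightarrow{AD}\rangle_A=\|\overrightarrow{AB}\|_A\|\overrightarrow{AD}\|_A$ if $t>0$, $=-\|\overrightarrow{AB}\|_A\|\overrightarrow{AD}\|_A$ if $t<0$. Axiom 2: $\langle(t)\overrightarrow{AB},\overrightarrow{CD}\rangle_A=t\langle\overrightarrow{AB},\overrightarrow{CD}\rangle_A$ for all arrows and all $t\in\mathbb{R}$. Relation $\Re$ on $\mathcal{P}_A$: $\overrightarrow{AB}\;\Re\;\overrightarrow{CD}$ iff either $A=B$ and $C=D$, or ($A\ne B$, $C\neq D$ and) $\|\overrightarrow{AB}\|_A=\|\overrightarrow{CD}\|_A$ and $\frac{\langle\overrightarrow{AB},\overrightarrow{CD}\rangle_A}{\|\overrightarrow{AB}\|_A\|\overrightarrow{CD}\|_A}=1$. Axiom 4: if $\overrightarrow{AB}\;\Re\;\overrightarrow{CD}$ and $\overrightarrow{EF}\;\Re\;\overrightarrow{GH}$,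 then $\langle\overrightarrow{AB},\overrightarrow{EF}\rangle_A=\langle\overrightarrow{CD},\overrightarrow{GH}\rangle_A$. (Then $\Re$ is an equivalence relation.) Axiom 5: for $A\neq B$ and any point $P$, there is a unique point $K$ with $\overrightarrow{AB}\;\Re\;\overrightarrow{PK}$ and a unique point $K'$ with $\overrightarrow{AB}\;\Re\;\overrightarrow{K'P}$. (For $A=B$ the same holds with $K=K'=P$.) Vectors: $\mathcal{P}_v$ is the set of $\Re$-equivalence classes $[\overrightarrow{AB}]$. Vector addition: given $[\overrightarrow{AB}],[\overrightarrow{CD}]$, choose any point $P$, let $K,L$ be the unique points with $\overrightarrow{KP}\;\Re\;\overrightarrow{AB}$ and $\overrightarrow{PL}\;\Re\;\overrightarrow{CD}$, and set $[\overrightarrow{AB}]+_V[\overrightarrow{CD}]=[\overrightarrow{KP}+_A\overrightarrow{PL}]=[\overrightarrow{KL}]$; this is well defined (independent of $P$ and of the representatives). *)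

(* Defs.v *)
From mathcomp Require Import all_boot all_order all_algebra.
From mathcomp Require Import boolp classical_sets functions cardinality reals.

Set Implicit Arguments.
Unset Strict Implicit.
Unset Printing Implicit Defensive.

Import Order.TTheory GRing.Theory Num.Theory.

Local Open Scope classical_set_scope.
Local Open Scope ring_scope.

Definition arrow (P : Type) : Type := (P * P)%type.

Definition arrow_opp (P : Type) (a : arrow P) : arrow P := (a.2, a.1).

(* The partial operation +_A: it takes a proof that it is defined. *)
Definition arrow_add (P : Type) (a b : arrow P) (_ : a.2 = b.1) : arrow P :=
  (a.1, b.2).

Section ArrowAxioms.
Variables (R : realType) (P : Type).
Variable ip : arrow P -> arrow P -> R.
Variable smul : R -> arrow P -> arrow P.

Definition arrow_norm (a : arrow P) : R := Num.sqrt (ip a a).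

Record pre_inner_product : Prop := PreInnerProduct {
  ip_ge0 : forall A B, 0 <= ip (A, B) (A, B);
  ip_eq0 : forall A B, ip (A, B) (A, B) = 0 <-> A = B;
  ip_sym : forall A B C D, ip (A, B) (C, D) = ip (C, D) (A, B);
  ip_add : forall A B C L M,
    ip (@arrow_add P (A, B) (B, C) erefl) (L, M) =
    ip (A, B) (L, M) + ip (B, C) (L, M);
  ip_opp : forall A B C D,
    ip (arrow_opp (A, B)) (C, D) = - ip (A, B) (C, D) }.

(* The point D is only assumed to exist, so the choice made by scalar
   multiplication is part of the data. *)
Record scalar_multiplication : Prop := ScalarMultiplication {
  smul_triv : forall t A B, A = B \/ t = 0 -> smul t (A, B) = (A, A);
  smul_spec : forall t A B, A <> B -> t <> 0 ->
    exists D, [/\ smul t (A, B) = (A, D),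
      arrow_norm (A, D) = `|t| * arrow_norm (A, B),
      0 < t -> ip (A, B) (A, D) = arrow_norm (A, B) * arrow_norm (A, D) &
      t < 0 -> ip (A, B) (A, D) = - (arrow_norm (A, B) * arrow_norm (A, D))] }.

Definition ip_homogeneous : Prop := forall t A B C D,
  ip (smul t (A, B)) (C, D) = t * ip (A, B) (C, D).

Definition arrow_rel (a b : arrow P) : Prop :=
  (a.1 = a.2 /\ b.1 = b.2) \/
  [/\ a.1 <> a.2, b.1 <> b.2, arrow_norm a = arrow_norm b &
      ip a b / (arrow_norm a * arrow_norm b) = 1].

Definition ip_compatible : Prop := forall A B C D E F G H,
  arrow_rel (A, B) (C, D) -> arrow_rel (E, F) (G, H) ->
  ip (A, B) (E, F) = ip (C, D) (G, H).

Definition unique_transport : Prop := forall A B Q, A <> B ->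
  (exists! K, arrow_rel (A, B) (Q, K)) /\
  (exists! K', arrow_rel (A, B) (K', Q)).

End ArrowAxioms.

Record arrowSpace (R : realType) := ArrowSpace {
  pt : Type;
  ip : arrow pt -> arrow pt -> R;
  smul : R -> arrow pt -> arrow pt;
  point_infinite : infinite_set [set: pt];
  ipP : pre_inner_product ip;
  smulP : scalar_multiplication ip smul;
  ip_smul : ip_homogeneous ip smul;
  ip_rel : ip_compatible ip;
  transport : unique_transport ip }.

Section Vectors.
Variables (R : realType) (X : arrowSpace R).
Local Notation pt := (pt X).
Local Notation ip := (@ip R X).
Local Notation rel := (arrow_rel ip).

Definition arrow_class (a : arrow pt) : set (arrow pt) :=
  [set b | rel a b].

Definition vector : Type :=
  {v : set (arrow pt) | exists a, v = arrow_class a}.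

Definition vec (a : arrow pt) : vector :=
  exist _ (arrow_class a) (ex_intro _ a erefl).

Lemma arrow_rel_sym (a b : arrow pt) : rel a b -> rel b a.
Proof.
case: a b => [A B] [C D] [[? ?]|[? ? n1 n2]]; [by left|right; split=> //].
by rewrite (ip_sym (ipP X)) [X in _ / X]mulrC.
Qed.

Lemma exists_point : exists Q : pt, True.
Proof.
have /infinite_setN0[Q _] := @point_infinite R X.
by exists Q.
Qed.

Lemma exists_tail (a : arrow pt) (Q : pt) : exists K, rel (K, Q) a.
Proof.
case: a => A B; have [->|AB] := pselect (A = B); first by exists Q; left.
have [_ [K [rK _]]] := transport Q AB.
by exists K; apply: arrow_rel_sym.
Qed.

Lemma exists_head (a : arrow pt) (Q : pt) : exists L, rel (Q, L) a.
Proof.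
case: a => A B; have [->|AB] := pselect (A = B); first by exists Q; left.
have [[K [rK _]] _] := transport Q AB.
by exists K; apply: arrow_rel_sym.
Qed.

(* The point Q and the representatives a, b are arbitrary choices; vaddE shows
   that the result does not depend on them. *)
Definition vadd (u v : vector) : vector :=
  let a := sval (cid (svalP u)) in
  let b := sval (cid (svalP v)) in
  let Q := sval (cid exists_point) in
  let K := sval (cid (exists_tail a Q)) in
  let L := sval (cid (exists_head b Q)) in
  vec (@arrow_add pt (K, Q) (Q, L) erefl).

Lemma arrow_rel_refl (a : arrow pt) : rel a a.
Proof.
case: a => A B; have [->|AB] := pselect (A = B); first by left.
have h0 : 0 < ip (A, B) (A, B).
  rewrite lt_neqAle (ip_ge0 (ipP X)) andbT eq_sym.
  by apply/eqP => /(ip_eq0 (ipP X)).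
right; split=> //.
by rewrite /arrow_norm -expr2 sqr_sqrtr ?divff ?gt_eqF ?ltW.
Qed.

Lemma arrow_relP (a b : arrow pt) : rel a b <-> ip a =1 ip b.
Proof.
case: a b => [A B] [C D]; split=> [r [E F]|e].
  exact: (ip_rel r (arrow_rel_refl (E, F))).
have eN : ip (A, B) (A, B) = ip (C, D) (C, D).
  by rewrite e (ip_sym (ipP X)) e.
have := arrow_rel_refl (A, B); rewrite /arrow_rel /= => -[[AB _]|[AB _ _ r]].
  left; split=> //; apply/(ip_eq0 (ipP X)); rewrite -eN.
  exact/(ip_eq0 (ipP X)).
right; split=> //.
- by move=> /(ip_eq0 (ipP X)); rewrite -eN => /(ip_eq0 (ipP X)).
- by rewrite /arrow_norm eN.
- by rewrite -[RHS]r /arrow_norm -eN e eN.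
Qed.

Lemma vecP (a b : arrow pt) : vec a = vec b <-> rel a b.
Proof.
split=> [/(congr1 sval)/= e|/arrow_relP e].
  by change (arrow_class a b); rewrite e; exact: arrow_rel_refl.
apply: eq_exist; apply/seteqP; split=> c /arrow_relP h; apply/arrow_relP => x.
  by rewrite -e h.
by rewrite e h.
Qed.

Lemma vaddE (a b : arrow pt) (Q K L : pt) :
  rel (K, Q) a -> rel (Q, L) b ->
  vadd (vec a) (vec b) = vec (@arrow_add pt (K, Q) (Q, L) erefl).
Proof.
move=> /arrow_relP ra /arrow_relP rb; rewrite /vadd.
case: (cid (svalP (vec a))) => a' /= ea; case: (cid (svalP (vec b))) => b' /= eb.
case: (cid exists_point) => Q' /= _.
case: (cid (exists_tail a' Q')) => K' /= /arrow_relP ra'.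
case: (cid (exists_head b' Q')) => L' /= /arrow_relP rb'.
have /vecP/arrow_relP {}ea : vec a = vec a' by apply: eq_exist.
have /vecP/arrow_relP {}eb : vec b = vec b' by apply: eq_exist.
apply/vecP/arrow_relP => -[x y].
by rewrite (ip_add (ipP X)) [RHS](ip_add (ipP X) K Q L) ra' rb' ra rb ea eb.
Qed.

End Vectors.

(* Main.v *)
(** Transporting arrows so that they are placed head to tail turns vector
    addition into arrow addition, for which both laws hold on the nose. *)
Require Import Defs.
From mathcomp Require Import all_boot all_order all_algebra.
From mathcomp Require Import boolp classical_sets reals.

(** Every class has a representative with any prescribed tail ([vec_from]), so three vectors can be
    laid end to end as [(A, B)], [(B, L)], [(L, M)]. By [vadd_chain] both bracketings then collapse
    to the class of [(A, M)]. *)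

Lemma vadd_chain (R : realType) (X : arrowSpace R) (A B C : pt X) :
  vadd (vec (A, B)) (vec (B, C)) = vec (A, C).
Proof. by rewrite (vaddE (arrow_rel_refl (A, B)) (arrow_rel_refl (B, C))). Qed.

Lemma vec_from (R : realType) (X : arrowSpace R) (a : arrow (pt X)) (Q : pt X) :
  exists L, vec a = vec (Q, L).
Proof. by have [L /vecP e] := exists_head a Q; exists L. Qed.

Theorem theorem54 (R : realType) (X : arrowSpace R) (A B C D E F : pt X) :
  vadd (vadd (vec (A, B)) (vec (C, D))) (vec (E, F)) =
    vadd (vec (A, B)) (vadd (vec (C, D)) (vec (E, F)))
  /\ (forall P : pt X, vadd (vec (A, B)) (vec (P, P)) = vec (A, B)).
Proof.
split=> [|P].
  have [L ->] := vec_from R X (C, D) B.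
  have [M ->] := vec_from R X (E, F) L.
  by rewrite !vadd_chain.
(* All degenerate arrows form a single class, so the zero vector can be moved to the head [B]. *)
have -> : vec (P, P) = vec (B, B) by apply/vecP; left.
exact: vadd_chain.
Qed.
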